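(* Let $R$ be a ring and let $0\to A_R \xrightarrow{f} B_R \xrightarrow{g} C_R \to 0$ be a cochain complex of right $R$-modules and right $R$-module morphisms (i.e. $gf=0$) such that the sequence $0\to P(A_R) \xrightarrow{P(f)} P(B_R) \xrightarrow{P(g)} P(C_R) \to 0$ is a short exact sequence in $\mathrm{Spec}(\mathrm{Mod}\text{-}R)$. Then the cochain complex $0\to A_R \xrightarrow{f} B_R \xrightarrow{g} C_R \to 0$ is a short $e$-exact sequence.
   Context: Rings are associative with identity $1\neq 0$, not necessarily commutative; modules are unitary right modules. A submodule $N\le M$ is essential in $M$ (written $N\le_e M$) if $N\cap X\neq 0$ for every nonzero submodule $X$ of $M$. A short $e$-exact sequence is a cochain complex $0\to A\xrightarrow{f}B\xrightarrow{g}C\to 0$ of right $R$-modules such that $f$ is a monomorphism, $f(A)$ is an essential submodule of $\ker(g)$, and $g(B)$ is an essential submodule of $C$. The spectral category $\mathrm{Spec}(\mathrm{Mod}\text{-}R)$ (Gabriel–Oberst) has the same objects as $\mathrm{Mod}\text{-}R$, and $\mathrm{Hom}_{\mathrm{Spec}(\mathrm{Mod}\text{-}R)}(A,B)=\varinjlim \mathrm{Hom}_R(A',B)$, where the direct limit is over the downward directed set of essential submodules $A'\le_e A$, with transition maps given by restriction. The composite of the classes of $f\colon A'\to B$ and $g\colon B'\to C$ (with $A'\le_e A$, $B'\le_e B$) is the class of $g\circ f$ restricted to $f^{-1}(B')$, which is essential in $A$. It is a Grothendieck category in which every short exact sequence splits. The canonical functor $P\colon\mathrm{Mod}\text{-}R\to\mathrm{Spec}(\mathrm{Mod}\text{-}R)$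 is the identity on objects and sends a morphism $f\colon A\to B$ to its class in the direct limit; it is left exact and sends essential monomorphisms to isomorphisms. *)

(* Defs.v *)
From HB Require Import structures.
From mathcomp Require Import all_boot all_order all_algebra.
From mathcomp Require Import generic_quotient boolp.

Set Implicit Arguments.
Unset Strict Implicit.
Unset Printing Implicit Defensive.

Import GRing.Theory.
Local Open Scope ring_scope.
Local Open Scope quotient_scope.

(* Right R-modules are the left modules over the converse ring R^c. Submodules
   and spectral Hom sets are defined for left modules over an arbitrary ring S,
   and are used with S := R^c. *)
Notation rmodType R := (GRing.Lmodule.type R^c).

Record zcategory := ZCategory {
  obj :> Type;
  hom : obj -> obj -> Type;
  idh : forall A, hom A A;
  comph : forall A B C, hom B C -> hom A B -> hom A C;
  zeroh : forall A B, hom A B;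
  comphA : forall A B C D (h : hom C D) (g : hom B C) (f : hom A B),
    comph h (comph g f) = comph (comph h g) f;
  comp1h : forall A B (f : hom A B), comph (idh B) f = f;
  comph1 : forall A B (f : hom A B), comph f (idh A) = f;
  comp0h : forall A B C (f : hom A B), comph (zeroh B C) f = zeroh A C;
  comph0 : forall A B C (g : hom B C), comph g (zeroh A B) = zeroh A C
}.

Arguments hom {_} _ _.
Arguments idh {_} _.
Arguments comph {_ A B C} _ _.
Arguments zeroh {_} _ _.

Section Exactness.
Variable C : zcategory.
Implicit Types A B D I K Q X Z : C.

Definition is_zero_object Z :=
  forall X, (forall f : hom X Z, f = zeroh X Z) /\
            (forall f : hom Z X, f = zeroh Z X).

Definition is_kernel K A B (k : hom K A) (f : hom A B) :=
  comph f k = zeroh K B /\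
  forall X (h : hom X A), comph f h = zeroh X B ->
    exists! u : hom X K, comph k u = h.

Definition is_cokernel A B Q (c : hom B Q) (f : hom A B) :=
  comph c f = zeroh A Q /\
  forall X (h : hom B X), comph h f = zeroh A X ->
    exists! u : hom Q X, comph u c = h.

(* As usual in abelian categories, the image of f is the kernel of the cokernel
   of f. *)
Definition is_image I A B (i : hom I B) (f : hom A B) :=
  exists (Q : C) (c : hom B Q), is_cokernel c f /\ is_kernel i c.

(* The image of f and the kernel of g agree as subobjects of B. *)
Definition exact_at A B D (f : hom A B) (g : hom B D) :=
  exists (I : C) (i : hom I B), is_image i f /\ is_kernel i g.

Definition short_exact A B D (f : hom A B) (g : hom B D) :=
  exists Z : C, is_zero_object Z /\
    [/\ exact_at (zeroh Z A) f, exact_at f g & exact_at g (zeroh D Z)].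

End Exactness.

Section Submodules.
Variables (S : nzRingType) (M N : lmodType S).

(* By classical logic, boolean predicates capture all submodules. *)

Definition fullsub : {pred M} := predT.

Lemma fullsub_submod : submod_closed fullsub.
Proof. by []. Qed.

HB.instance Definition _ := GRing.isSubmodClosed.Build S M fullsub fullsub_submod.

Variable f : {linear M -> N}.

Definition kersub : {pred M} := [pred x | f x == 0].

Lemma kersub_submod : submod_closed kersub.
Proof.
split=> [|a x y]; rewrite !inE ?linear0 // => /eqP fx /eqP fy.
by rewrite linearP fx fy scaler0 addr0.
Qed.

HB.instance Definition _ := GRing.isSubmodClosed.Build S M kersub kersub_submod.

Definition imsub : {pred N} := [pred y | `[< exists x, f x = y >]].

Lemma imsub_submod : submod_closed imsub.
Proof.
split=> [|a x y]; rewrite !inE.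
  by apply/asboolP; exists 0; rewrite linear0.
move=> /asboolP[u fu] /asboolP[v fv]; apply/asboolP.
by exists (a *: u + v); rewrite linearP fu fv.
Qed.

HB.instance Definition _ := GRing.isSubmodClosed.Build S N imsub imsub_submod.

(* U is an essential submodule of V, both being submodules of M. *)
Definition essential (U V : submodClosed M) :=
  {subset U <= V} /\
  forall X : submodClosed M, {subset X <= V} ->
    (exists2 x, x \in X & x != 0) ->
    exists x, [/\ x \in U, x \in X & x != 0].

End Submodules.

Arguments fullsub {S} M _.

Section SubmoduleAsModule.
Variables (S : nzRingType) (M : lmodType S).

Inductive submod (U : submodClosed M) : predArgType :=
  Submod (x : M) & x \in U.

Definition submod_val U (u : submod U) : M := let: Submod x _ := u in x.

Section Instances.
Variable U : submodClosed M.

HB.instance Definition _ := [isSub of submod U for @submod_val U].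
HB.instance Definition _ := [Choice of submod U by <:].
HB.instance Definition _ :=
  GRing.SubChoice_isSubLmodule.Build S M _ (submod U) (submodClosedP U).

Lemma submod_valP (u : submod U) : submod_val u \in U.
Proof. exact: valP. Qed.

Lemma submod_val_linear : linear (@submod_val U).
Proof. by []. Qed.

HB.instance Definition _ :=
  GRing.isLinear.Build S (submod U) M _ (@submod_val U) submod_val_linear.

End Instances.

Section Inclusion.
Variables (U V : submodClosed M) (UV : {subset U <= V}).

Definition incl (u : submod U) : submod V := Submod (UV (submod_valP u)).

Lemma incl_linear : linear incl.
Proof. by move=> a x y; apply: val_inj. Qed.

HB.instance Definition _ :=
  GRing.isLinear.Build S (submod U) (submod V) _ incl incl_linear.

End Inclusion.

Section Intersection.
Variables U V : submodClosed M.

Definition intersub : {pred M} := [predI U & V].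

Lemma intersub_submod : submod_closed intersub.
Proof.
split=> [|a x y]; rewrite !inE; first by rewrite !rpred0.
by move=> /andP[xU xV] /andP[yU yV]; rewrite !rpredD ?rpredZ.
Qed.

HB.instance Definition _ :=
  GRing.isSubmodClosed.Build S M intersub intersub_submod.

Lemma intersub_l : {subset intersub <= U}.
Proof. by move=> x; rewrite inE => /andP[]. Qed.

Lemma intersub_r : {subset intersub <= V}.
Proof. by move=> x; rewrite inE => /andP[]. Qed.

End Intersection.

Lemma essential_full : essential (fullsub M) (fullsub M).
Proof. by split=> // X _ [x xX x0]; exists x. Qed.

Lemma essential_inter (U V : submodClosed M) :
  essential U (fullsub M) -> essential V (fullsub M) ->
  essential (intersub U V) (fullsub M).
Proof.
move=> [_ eU] [_ eV]; split=> // X _ X0.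
have [x [xU xX x0]] := eU X (fun _ _ => isT) X0.
have XU0 : exists2 x, x \in intersub X U & x != 0.
  by exists x => //; rewrite inE xX.
have [y [yV yXU y0]] := eV (intersub X U) (fun _ _ => isT) XU0.
exists y; split=> //; last exact: intersub_l yXU.
by rewrite inE yV (intersub_r yXU).
Qed.

End SubmoduleAsModule.

Section Preimage.
Variables (S : nzRingType) (A B : lmodType S).
Variables (U : submodClosed A) (f : {linear submod U -> B}) (V : submodClosed B).

(* The preimage of V under a morphism f defined on the submodule U of A, as a
   submodule of A. *)
Definition presub : {pred A} :=
  [pred x | `[< exists2 u : submod U, submod_val u = x & f u \in V >]].

Lemma presub_submod : submod_closed presub.
Proof.
split=> [|a x y]; rewrite !inE.
  by apply/asboolP; exists 0; rewrite ?linear0 ?rpred0.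
move=> /asboolP[u <- fu] /asboolP[v <- fv]; apply/asboolP.
by exists (a *: u + v); rewrite linearP // rpredD ?rpredZ.
Qed.

HB.instance Definition _ := GRing.isSubmodClosed.Build S A presub presub_submod.

Lemma presubW : {subset presub <= U}.
Proof. by move=> x; rewrite inE => /asboolP[u <- _]; exact: submod_valP. Qed.

Lemma presub_mem (x : submod presub) : f (incl presubW x) \in V.
Proof.
case: x => x xP; have := xP; rewrite inE => /asboolP[u ux fu].
by rewrite (_ : incl _ _ = u) //; apply: val_inj; rewrite /= ux.
Qed.

Definition prehom (x : submod presub) : submod V := Submod (presub_mem x).

Lemma prehom_linear : linear prehom.
Proof. by move=> a x y; apply: val_inj; rewrite /= !linearP. Qed.

HB.instance Definition _ :=
  GRing.isLinear.Build S (submod presub) (submod V) _ prehom prehom_linear.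

Lemma presub_essential :
  essential U (fullsub A) -> essential V (fullsub B) ->
  essential presub (fullsub A).
Proof.
move=> [_ eU] [_ eV]; split=> // X _ X0.
have [x [xU xX x0]] := eU X (fun _ _ => isT) X0.
pose h : {linear submod (intersub X U) -> B} := f \o incl (@intersub_r _ _ X U).
have [fx|fx] := eqVneq (f (Submod xU)) 0.
  exists x; split=> //; rewrite inE; apply/asboolP.
  by exists (Submod xU); rewrite ?fx ?rpred0.
have h0 : exists2 y, y \in imsub h & y != 0.
  exists (f (Submod xU)) => //; rewrite inE; apply/asboolP.
  have xXU : x \in intersub X U by rewrite inE xX.
  by exists (Submod xXU) => /=; congr (f _); apply: val_inj.
have [y [yV yh y0]] := eV (imsub h) (fun _ _ => isT) h0.
move: yh; rewrite inE => /asboolP[[z zXU] /= fz].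
exists z; split; last 1 first.
- apply: contra_neq y0 => z0; rewrite -fz (_ : incl _ _ = 0) ?linear0 //.
  exact: val_inj.
- rewrite inE; apply/asboolP; exists (incl (@intersub_r _ _ X U) (Submod zXU)) => //.
  by rewrite fz.
- exact: intersub_l zXU.
Qed.

End Preimage.

Arguments prehom {S A B U} f V x.
Arguments presub_essential {S A B U} f V _ _.

Section SpecHom.
Variables (S : nzRingType) (A B : lmodType S).

(* A morphism to B from an essential submodule of A. *)
Record ehom := EHom {
  edom : submodClosed A;
  edomP : essential edom (fullsub A);
  emap :> {linear submod edom -> B}
}.

HB.instance Definition _ := gen_eqMixin ehom.
HB.instance Definition _ := gen_choiceMixin ehom.

(* Two such morphisms have the same image in the direct limit when they have
   the same restriction to some smaller essential submodule. *)
Definition ehom_eqv_prop (f g : ehom) :=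
  exists (D : submodClosed A)
    (Df : {subset D <= edom f}) (Dg : {subset D <= edom g}),
    essential D (fullsub A) /\ f \o incl Df =1 g \o incl Dg.

Definition ehom_eqv : rel ehom := fun f g => `[< ehom_eqv_prop f g >].

Lemma ehom_eqv_equiv : equiv_class_of ehom_eqv.
Proof.
split=> [f|f g|g f h].
- apply/asboolP; exists (edom f), (fun _ => id), (fun _ => id).
  by split=> //; exact: edomP.
- by apply/asboolP/asboolP=> -[D [Df [Dg [De fg]]]]; exists D, Dg, Df; split.
- move=> /asboolP[D [Df [Dg [De fg]]]] /asboolP[E [Eg [Eh [Ee gh]]]].
  apply/asboolP; pose I : submodClosed A := intersub D E.
  exists I, (fun x xI => Df x (intersub_l xI)), (fun x xI => Eh x (intersub_r xI)).
  split=> [|[x xI]]; first exact: essential_inter.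
  have /= := fg (Submod (intersub_l xI)); have /= := gh (Submod (intersub_r xI)).
  rewrite (_ : incl Eg _ = incl Dg (Submod (intersub_l xI))) => [e1 e2|].
    transitivity (f (incl Df (Submod (intersub_l xI)))).
      by congr (emap f _); apply: val_inj.
    by rewrite e2 e1; congr (emap h _); apply: val_inj.
  exact: val_inj.
Qed.

Canonical ehom_equiv := EquivRelPack ehom_eqv_equiv.

(* The direct limit of Hom(A', B) over the essential submodules A' of A. *)
Definition spec_hom := {eq_quot ehom_eqv}.

Lemma spec_homP (f g : ehom) :
  \pi_spec_hom f = \pi_spec_hom g <-> ehom_eqv_prop f g.
Proof.
split; last by move=> fg; apply/eqmodP/asboolP.
by move/eqmodP/asboolP.
Qed.

(* The class of an everywhere defined morphism. *)
Definition ehom_of (f : {linear A -> B}) : ehom :=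
  @EHom (fullsub A) (@essential_full S A) (f \o @submod_val S A (fullsub A)).

End SpecHom.

Section SpecComp.
Variables (S : nzRingType) (A B C : lmodType S).

(* g after f, defined on the preimage under f of the domain of g. *)
Definition ehom_comp (g : ehom B C) (f : ehom A B) : ehom A C :=
  EHom (presub_essential f (edom g) (edomP f) (edomP g)) (g \o prehom f (edom g)).

Definition spec_comp (g : spec_hom B C) (f : spec_hom A B) : spec_hom A C :=
  \pi_(spec_hom A C) (ehom_comp (repr g) (repr f)).

End SpecComp.

Section SpecCategory.
Variable S : nzRingType.
Implicit Types A B C D : lmodType S.

Lemma ehom_eqvI A B (f g : ehom A B) (D : submodClosed A)
    (Df : {subset D <= edom f}) (Dg : {subset D <= edom g}) :
  essential D (fullsub A) ->
  (forall x (xD : x \in D), f (Submod (Df x xD)) = g (Submod (Dg x xD))) ->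
  \pi_(spec_hom A B) f = \pi_(spec_hom A B) g.
Proof.
move=> De fg; apply/spec_homP; exists D, Df, Dg; split=> // -[x xD] /=.
transitivity (f (Submod (Df x xD))).
  by congr (emap f _); apply: val_inj.
by rewrite fg; congr (emap g _); apply: val_inj.
Qed.

Lemma ehom_compE A B C (g : ehom B C) (f : ehom A B) x
    (xU : x \in edom f) (xV : f (Submod xU) \in edom g)
    (xc : x \in edom (ehom_comp g f)) :
  ehom_comp g f (Submod xc) = g (Submod xV).
Proof.
rewrite /=; congr (emap g _); apply: val_inj => /=.
by congr (emap f _); apply: val_inj.
Qed.

Lemma ehom_comp_dom A B C (g : ehom B C) (f : ehom A B) x :
  x \in edom (ehom_comp g f) <->
  exists xU : x \in edom f, f (Submod xU) \in edom g.
Proof.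
rewrite inE; split=> [/asboolP[[y yU] /= <- fy]|[xU fx]]; first by exists yU.
by apply/asboolP; exists (Submod xU).
Qed.

Lemma ehom_comp_eqv A B C (g g' : ehom B C) (f f' : ehom A B) :
  ehom_eqv_prop g g' -> ehom_eqv_prop f f' ->
  \pi_(spec_hom A C) (ehom_comp g f) = \pi_(spec_hom A C) (ehom_comp g' f').
Proof.
move=> [E [Eg [Eg' [Ee gg']]]] [D [Df [Df' [De ff']]]].
pose fD : {linear submod D -> B} := f \o incl Df.
have fDE (x : A) (xD : x \in D) : fD (Submod xD) = f (Submod (Df x xD)).
  by rewrite /=; congr (emap f _); apply: val_inj.
have fDE' (x : A) (xD : x \in D) : fD (Submod xD) = f' (Submod (Df' x xD)).
  by rewrite [LHS](ff' (Submod xD)) /=; congr (emap f' _); apply: val_inj.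
pose I : submodClosed A := presub fD E.
have ID x : x \in I -> exists xD : x \in D, fD (Submod xD) \in E.
  by rewrite inE => /asboolP[[y yD] /= <- fy]; exists yD.
have If : {subset I <= edom (ehom_comp g f)}.
  move=> x /ID[xD xE]; apply/ehom_comp_dom; exists (Df x xD).
  by rewrite -fDE; exact: (Eg _ xE).
have If' : {subset I <= edom (ehom_comp g' f')}.
  move=> x /ID[xD xE]; apply/ehom_comp_dom; exists (Df' x xD).
  by rewrite -fDE'; exact: (Eg' _ xE).
apply: (@ehom_eqvI _ _ _ _ I If If'); first exact: presub_essential.
move=> x xI; have [xD xE] := ID x xI.
have xV : f (Submod (Df x xD)) \in edom g by rewrite -fDE; exact: (Eg _ xE).
have xV' : f' (Submod (Df' x xD)) \in edom g' by rewrite -fDE'; exact: (Eg' _ xE).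
rewrite (ehom_compE xV) (ehom_compE xV').
transitivity (g (incl Eg (Submod xE))).
  by congr (emap g _); apply: val_inj; rewrite /= -fDE.
rewrite [LHS](gg' (Submod xE)) /=.
by congr (emap g' _); apply: val_inj; rewrite /= -fDE'.
Qed.

Lemma spec_compE A B C (g : ehom B C) (f : ehom A B) :
  spec_comp (\pi_(spec_hom B C) g) (\pi_(spec_hom A B) f) =
  \pi_(spec_hom A C) (ehom_comp g f).
Proof.
by apply: ehom_comp_eqv; apply/spec_homP; rewrite reprK.
Qed.

Definition spec_id A : spec_hom A A := \pi_(spec_hom A A) (ehom_of idfun).

Definition spec_zero A B : spec_hom A B :=
  \pi_(spec_hom A B) (ehom_of (\0 : {linear A -> B})).

Lemma spec_compA A B C D (h : spec_hom C D) (g : spec_hom B C)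
    (f : spec_hom A B) :
  spec_comp h (spec_comp g f) = spec_comp (spec_comp h g) f.
Proof.
rewrite -[h]reprK -[g]reprK -[f]reprK; move: (repr h) (repr g) (repr f).
move=> {f g h} h g f.
rewrite (spec_compE g f) (spec_compE h g).
rewrite (spec_compE h (ehom_comp g f)) (spec_compE (ehom_comp h g) f).
pose I := edom (ehom_comp h (ehom_comp g f)).
have If : {subset I <= edom (ehom_comp (ehom_comp h g) f)}.
  move=> x /ehom_comp_dom[xgf]; have /ehom_comp_dom[xf xg] := xgf.
  rewrite (ehom_compE xg) => xh; apply/ehom_comp_dom; exists xf.
  by apply/ehom_comp_dom; exists xg.
apply: (@ehom_eqvI _ _ _ _ I (fun _ => id) If); first exact: edomP.
move=> x xI; have /ehom_comp_dom[xgf xh] := xI.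
have /ehom_comp_dom[xf xg] := xgf; rewrite (ehom_compE xh).
have xh' : g (Submod xg) \in edom h by rewrite -(ehom_compE xg xgf).
have xhg : f (Submod xf) \in edom (ehom_comp h g).
  by apply/ehom_comp_dom; exists xg.
rewrite (ehom_compE xhg) (ehom_compE xh').
by congr (emap h _); apply: val_inj; rewrite [LHS](ehom_compE xg).
Qed.

Lemma spec_comp1l A B (f : spec_hom A B) : spec_comp (spec_id B) f = f.
Proof.
rewrite -[f]reprK; move: (repr f) => {}f; rewrite spec_compE.
have fI : {subset edom f <= edom (ehom_comp (ehom_of idfun) f)}.
  by move=> x xf; apply/ehom_comp_dom; exists xf.
apply: (@ehom_eqvI _ _ _ _ (edom f) fI (fun _ => id)); first exact: edomP.
by move=> x xf; rewrite (@ehom_compE _ _ _ (ehom_of idfun) f x xf isT).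
Qed.

Lemma spec_comp1r A B (f : spec_hom A B) : spec_comp f (spec_id A) = f.
Proof.
rewrite -[f]reprK; move: (repr f) => {}f; rewrite spec_compE.
have fI : {subset edom f <= edom (ehom_comp f (ehom_of idfun))}.
  by move=> x xf; apply/ehom_comp_dom; exists isT.
apply: (@ehom_eqvI _ _ _ _ (edom f) fI (fun _ => id)); first exact: edomP.
by move=> x xf; rewrite (@ehom_compE _ _ _ f (ehom_of idfun) x isT xf).
Qed.

Lemma spec_comp0l A B C (f : spec_hom A B) :
  spec_comp (spec_zero B C) f = spec_zero A C.
Proof.
rewrite -[f]reprK; move: (repr f) => {}f; rewrite spec_compE.
pose I := edom (ehom_comp (ehom_of (\0 : {linear B -> C})) f).
have I0 : {subset I <= edom (ehom_of (\0 : {linear A -> C}))} by [].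
by apply: (@ehom_eqvI _ _ _ _ I (fun _ => id) I0); first exact: edomP.
Qed.

Lemma spec_comp0r A B C (g : spec_hom B C) :
  spec_comp g (spec_zero A B) = spec_zero A C.
Proof.
rewrite -[g]reprK; move: (repr g) => {}g; rewrite spec_compE.
have fI : {subset fullsub A <= edom (ehom_comp g (ehom_of (\0 : {linear A -> B})))}.
  by move=> x _; apply/ehom_comp_dom; exists isT; rewrite /= rpred0.
have f0 : {subset fullsub A <= edom (ehom_of (\0 : {linear A -> C}))} by [].
apply: (@ehom_eqvI _ _ _ _ (fullsub A) fI f0); first exact: essential_full.
move=> x xA; have x0 : (ehom_of (\0 : {linear A -> B})) (Submod xA) \in edom g.
  by rewrite /= rpred0.
rewrite (ehom_compE x0) /= (_ : Submod x0 = 0) ?linear0 //; exact: val_inj.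
Qed.

End SpecCategory.

(* The Gabriel-Oberst spectral category Spec(Mod-R). *)
Definition Spec (R : nzRingType) : zcategory :=
  @ZCategory (rmodType R) (@spec_hom R^c) (@spec_id R^c) (@spec_comp R^c)
    (@spec_zero R^c) (@spec_compA R^c) (@spec_comp1l R^c) (@spec_comp1r R^c)
    (@spec_comp0l R^c) (@spec_comp0r R^c).

(* The canonical functor P : Mod-R -> Spec(Mod-R), the identity on objects. *)
Section CanonicalFunctor.
Variable R : nzRingType.
Implicit Types A B C : rmodType R.

Definition Pobj A : Spec R := A.

Definition P A B (f : {linear A -> B}) : hom (Pobj A) (Pobj B) :=
  \pi_(spec_hom A B) (ehom_of f).

Lemma P_id A : P (idfun : {linear A -> A}) = idh (Pobj A).
Proof. by []. Qed.

Lemma P_comp A B C (g : {linear B -> C}) (f : {linear A -> B}) :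
  P (g \o f) = comph (P g) (P f).
Proof.
rewrite /P /= spec_compE.
have fI : {subset fullsub A <= edom (ehom_comp (ehom_of g) (ehom_of f))}.
  by move=> x _; apply/ehom_comp_dom; exists isT.
have f0 : {subset fullsub A <= edom (ehom_of (g \o f))} by [].
by apply: (@ehom_eqvI _ _ _ _ _ (fullsub A) f0 fI); first exact: essential_full.
Qed.

End CanonicalFunctor.

Definition short_e_exact (S : nzRingType) (A B C : lmodType S)
    (f : {linear A -> B}) (g : {linear B -> C}) :=
  [/\ forall x, g (f x) = 0, injective f,
      essential (imsub f) (kersub g) & essential (imsub g) (fullsub C)].

(* Main.v *)
(* In Spec(Mod-R), exactness at B makes q k = 0 whenever q f = 0 and g k = 0.
   Apply this to the projection q : B -> B / f(A) and the inclusion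
   k : ker g -> B: a morphism h is killed by P exactly when ker h is essential,
   and the kernel of q k is f(A), so f(A) is essential in ker g.  Taking instead
   one of the two test morphisms to be an identity shows that ker f is zero and
   that g(B) is essential in C. *)
From HB Require Import structures.
From mathcomp Require Import all_boot all_order all_algebra.
From mathcomp Require Import generic_quotient ring_quotient boolp.
Require Import Defs.
Import GRing.Theory.
Local Open Scope ring_scope.

Set Implicit Arguments.
Unset Strict Implicit.
Unset Printing Implicit Defensive.

Section QuotientModule.
Variables (S : nzRingType) (M : lmodType S) (U : submodClosed M).
Local Open Scope quotient_scope.

(* U as a subgroup: a submodClosed predicate over a semiring of scalars need not
   be stable under opposite, so it is not a zmodClosed one. *)
Definition zmod_sub : {pred M} := U.

HB.instance Definition _ :=
  GRing.isZmodClosed.Build M zmod_sub (GRing.submod_closedB (submodClosedP U)).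

Definition quotmod := Quotient.quot zmod_sub.

HB.instance Definition _ := GRing.Zmodule.on quotmod.

Definition quot_proj (x : M) : quotmod := \pi_(Quotient.quot zmod_sub) x.

Definition quot_scale (a : S) (x : quotmod) : quotmod :=
  quot_proj (a *: repr (x : Quotient.quot zmod_sub)).

Lemma quot_proj_eq (x y : M) : quot_proj x = quot_proj y <-> x - y \in U.
Proof.
rewrite /quot_proj; split=> [/eqP|xy]; first by rewrite -Quotient.idealrBE.
by apply/eqP; rewrite -Quotient.idealrBE.
Qed.

Lemma quot_projD : {morph quot_proj : x y / x + y}.
Proof. by move=> x y; rewrite /quot_proj piE. Qed.

(** The representative chosen by [quot_scale] differs from [x] by an element of [U], and [U] is
    stable under scaling. The module axioms of the quotient then descend from those of [M]. *)
Lemma quot_projZ a x : quot_proj (a *: x) = quot_scale a (quot_proj x).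
Proof.
apply/quot_proj_eq; rewrite -scalerBr rpredZ //.
by apply/quot_proj_eq; rewrite /quot_proj reprK.
Qed.

Lemma quot_proj_surj (y : quotmod) : exists x, y = quot_proj x.
Proof.
by exists (repr (y : Quotient.quot zmod_sub)); rewrite /quot_proj reprK.
Qed.

Lemma quot_scaleA a b x :
  quot_scale a (quot_scale b x) = quot_scale (a * b) x.
Proof. by have [y ->] := quot_proj_surj x; rewrite -!quot_projZ scalerA. Qed.

Lemma quot_scale1 : left_id 1 quot_scale.
Proof.
by move=> x; have [y ->] := quot_proj_surj x; rewrite -quot_projZ scale1r.
Qed.

Lemma quot_scaleDr : right_distributive quot_scale +%R.
Proof.
move=> a x y; have [u ->] := quot_proj_surj x; have [v ->] := quot_proj_surj y.
by rewrite -quot_projD -!quot_projZ scalerDr quot_projD.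
Qed.

Lemma quot_scaleDl x : {morph quot_scale^~ x : a b / a + b}.
Proof.
move=> a b; have [u ->] := quot_proj_surj x.
by rewrite -!quot_projZ scalerDl quot_projD.
Qed.

HB.instance Definition _ := GRing.Zmodule_isLmodule.Build S quotmod
  quot_scaleA quot_scale1 quot_scaleDr quot_scaleDl.

Lemma quot_proj_linear : linear quot_proj.
Proof. by move=> a x y; rewrite quot_projD quot_projZ. Qed.

HB.instance Definition _ :=
  GRing.isLinear.Build S M quotmod _ quot_proj quot_proj_linear.

Lemma quot_proj_eq0 x : quot_proj x = 0 <-> x \in U.
Proof. by rewrite -(linear0 quot_proj) quot_proj_eq subr0. Qed.

End QuotientModule.

Lemma essentialS (S : nzRingType) (M : lmodType S) (D U V : submodClosed M) :
  {subset D <= U} -> {subset U <= V} -> essential D V -> essential U V.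
Proof.
move=> DU UV [_ eD]; split=> // X XV X0.
by have [x [xD xX x0]] := eD X XV X0; exists x; split=> //; apply: DU.
Qed.

(** Carries essentiality from the module [submod V], where [P_eq0] produces it, back to submodules
    of [M]. *)
Lemma essential_submod (S : nzRingType) (M : lmodType S)
    (U V : submodClosed M) (W : submodClosed (submod V)) :
  {subset U <= V} -> (forall w, w \in W -> submod_val w \in U) ->
  essential W (fullsub (submod V)) -> essential U V.
Proof.
move=> UV WU [_ eW]; split=> // X XV [x xX x0].
(* The kernel of the composite [V -> M -> M / X] is [X] seen as a submodule of [submod V]. *)
pose h : {linear submod V -> quotmod X} := quot_proj X \o @submod_val S M V.
have hE u : (u \in kersub h) = (submod_val u \in X).
  by apply/eqP/idP => /quot_proj_eq0.
have h0 : exists2 u, u \in kersub h & u != 0.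
  exists (Submod (XV x xX)); first by rewrite hE.
  by apply: contra_neq x0 => /(congr1 (@submod_val _ _ _)).
have [w [wW]] := eW (kersub h) (fun _ _ => isT) h0.
by rewrite hE => wX w0; exists (submod_val w); split=> //; exact: WU.
Qed.

(** With [i] the image of [f] and [c] its cokernel, [k] factors through [i] because [i] is a kernel
    of [g], [q] factors through [c], and [c i = 0]. *)
Lemma exact_at_comp0 (C : zcategory) (A B D K Q : C) (f : hom A B) (g : hom B D)
    (k : hom K B) (q : hom B Q) :
  exact_at f g -> comph g k = zeroh K D -> comph q f = zeroh A Q ->
  comph q k = zeroh K Q.
Proof.
case=> I [i [[T [c [[_ coker_c] [ci0 _]]]] [_ ker_i]]] gk0 qf0.
have [u [iu _]] := ker_i _ _ gk0; have [v [vc _]] := coker_c _ _ qf0.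
by rewrite -vc -iu comphA -(comphA v) ci0 comph0 comp0h.
Qed.

Section CanonicalFunctorZero.
Variables (R : nzRingType) (A B : rmodType R).

Lemma P_null (h : {linear A -> B}) :
  (forall x, h x = 0) -> P h = zeroh (Pobj A) (Pobj B).
Proof.
move=> h0; rewrite /P /= /spec_zero.
apply: (@ehom_eqvI _ A B (ehom_of h) (ehom_of \0) (fullsub A)
  (fun _ => id) (fun _ => id)).
  exact: essential_full.
by move=> x xA; exact: h0.
Qed.

(** Vanishing in the direct limit means that [h] is zero on some essential submodule, which the
    kernel contains. *)
Lemma P_eq0 (h : {linear A -> B}) :
  P h = zeroh (Pobj A) (Pobj B) -> essential (kersub h) (fullsub A).
Proof.
move=> /spec_homP[D [Df [Dg [De h0]]]]; apply: essentialS De => // x xD.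
by apply/eqP; exact: h0 (Submod xD).
Qed.

End CanonicalFunctorZero.

Theorem corollary2p3 (R : nzRingType) (A B C : rmodType R)
    (f : {linear A -> B}) (g : {linear B -> C}) :
  (forall x : A, g (f x) = 0) ->
  short_exact (P f) (P g) ->
  short_e_exact f g.
Proof.
move=> gf0 [Z [_ [exA exB exC]]].
have imP (M N : rmodType R) (h : {linear M -> N}) x : h x \in imsub h.
  by apply/asboolP; exists x.
have proj_comp0 (M N : rmodType R) (h : {linear M -> N}) :
    comph (P (quot_proj (imsub h) : {linear N -> quotmod (imsub h)})) (P h) =
      zeroh (Pobj M) (Pobj _).
  by rewrite -P_comp; apply: P_null => x; apply/quot_proj_eq0; exact: imP.
have incl_comp0 (M N : rmodType R) (h : {linear M -> N}) :
    comph (P h) (P (@submod_val _ M _ : {linear submod (kersub h) -> M})) =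
      zeroh (Pobj _) (Pobj N).
  by rewrite -P_comp; apply: P_null => -[x xh]; exact/eqP.
split=> //.
- apply: raddf_inj => x fx0; apply/eqP; apply: contraT => x0.
  (* Here [q] is the identity of [A], so [P] kills the inclusion of [ker f]. The kernel of this
     inclusion is zero, yet essential in [ker f], which forces [ker f = 0]. *)
  have := exact_at_comp0 exA (incl_comp0 _ _ f) (comph0 _ (idh (Pobj A))).
  rewrite comp1h => /P_eq0[_ ek].
  have xK : x \in kersub f by exact/eqP.
  have K0 : exists2 u, u \in fullsub (submod (kersub f)) & u != 0.
    by exists (Submod xK).
  have [u [/eqP u0 _]] := ek (fullsub _) (fun _ _ => isT) K0.
  by case/eqP; apply: val_inj.
- have := exact_at_comp0 exB (incl_comp0 _ _ g) (proj_comp0 _ _ f).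
  rewrite -P_comp => /P_eq0; apply: essential_submod.
    by move=> y /asboolP[x <-]; exact/eqP.
  by move=> w /eqP/quot_proj_eq0.
(* Here [k] is the identity of [C], so [P] kills the projection of [C] onto [C / g(B)], whose kernel
   is [g(B)]. *)
- have := exact_at_comp0 exC (comp0h _ (idh (Pobj C))) (proj_comp0 _ _ g).
  rewrite comph1 => /P_eq0; apply: essentialS => // y.
  by move=> /eqP/quot_proj_eq0.
Qed.
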